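(* Let $\mathfrak{g}$ be a finite dimensional real Lie algebra and $(\tau,V_\tau)$ a finite dimensional representation of $\mathfrak{g}$. Let $W_\tau(\mathfrak{g}^* )=S\mathfrak{g}^*\otimes\wedge\mathfrak{g}^*\otimes\mathrm{End}\,V_\tau$ be the classical covariant Weil algebra, $d^{W,\tau}$ its covariant differential, and $C=v^a\tau_a\in W_\tau(\mathfrak{g}^* )$ its curvature. Then for all $x\in W_\tau(\mathfrak{g}^* )$, $$d^{W,\tau}(d^{W,\tau}x)=[C,x].$$
   Context: Conventions: $e_1,\dots,e_n$ is a basis of $\mathfrak{g}$ with structure constants $[e_i,e_j]=f_{ij}^k e_k$; repeated indices are summed. Let $e^i$ be the dual basis of $\mathfrak{g}^*$; the corresponding generators of $S\mathfrak{g}^*$ are denoted $v^i$ and those of $\wedge\mathfrak{g}^*$ are denoted $y^i$. Write $\tau_a=\tau(e_a)\in\mathrm{End}\,V_\tau$. $W_\tau(\mathfrak{g}^* )=S\mathfrak{g}^*\otimes\wedge\mathfrak{g}^*\otimes\mathrm{End}\,V_\tau$ is the tensor product algebra (elements of the three factors commute with each other; tensor symbols are omitted), graded with $\deg v^i=2$, $\deg y^i=1$, $\deg A=0$ for $A\in\mathrm{End}\,V_\tau$. $[\cdot,\cdot]$ denotes the super-commutator (since $C$ is even, $[C,x]=Cx-xC$). The covariant differential $d^{W,\tau}$ is the (graded) derivation of degree $1$ of $W_\tau(\mathfrak{g}^* )$ given on generators by $$d^{W,\tau}y^a=v^a-\tfrac12 f^a_{jk}y^jy^k,\qquad d^{W,\tau}v^a=-f^a_{jk}y^jv^k,\qquad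 d^{W,\tau}A=y^a[\tau_a,A]\quad(A\in\mathrm{End}\,V_\tau).$$ *)

(* Defs.v *)
From HB Require Import structures.
From mathcomp Require Import all_boot all_order all_algebra reals.
From mathcomp Require Import mpoly zify ring.

Set Implicit Arguments.
Unset Strict Implicit.
Unset Printing Implicit Defensive.

Import GRing.Theory.
Local Open Scope ring_scope.

Section LieAlgebra.
Context (R : realType) (g V : vectType R).
Implicit Types (br : {bilinear g -> g -> g}).

Definition is_lie_bracket br :=
  (forall x, br x x = 0) /\
  (forall x y z, br x (br y z) + br y (br z x) + br z (br x y) = 0).

Definition is_lie_representation br (tau : {linear g -> 'End(V)}) :=
  forall x y, tau (br x y) = ((tau x \o tau y) - (tau y \o tau x))%VF.

(* [struct_const br e i j k] is f_{ij}^k, i.e. [e_i, e_j] = f_{ij}^k e_k. *)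
Definition struct_const br n (e : n.-tuple g) (i j k : 'I_n) : R :=
  coord e k (br e`_i e`_j).

End LieAlgebra.

(* The exterior algebra on generators y^0, ..., y^(n-1) with coefficients in a *)
(* (not necessarily commutative) ring B, i.e. B tensored with the exterior     *)
(* algebra of the free module of rank n.  The function f stands for            *)
(* \sum_I f(I) y^I, where y^I is the product of the y^i, i in I, taken in      *)
(* increasing order, so that                                                   *)
(*   y^I y^J = (-1)^(inversions I J) y^(I :|: J) if I and J are disjoint,      *)
(*   y^I y^J = 0 otherwise.                                                    *)
(* {ffun _ -> B} itself carries the pointwise ring structure; the alias        *)
(* ext_alg inherits only its additive structure.                               *)
Definition ext_alg (n : nat) (B : pzRingType) := {ffun {set 'I_n} -> B}.

HB.instance Definition _ (n : nat) (B : pzRingType) :=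
  GRing.Zmodule.copy (ext_alg n B) {ffun {set 'I_n} -> B}.

Definition inversions (n : nat) (I J : {set 'I_n}) : nat :=
  \sum_(i in I) \sum_(j in J) (j < i)%N.

(* Locked: otherwise failed conversion tests unfold products of elements down  *)
(* to products of polynomials.                                                 *)
HB.lock Definition ext_mul (n : nat) (B : pzRingType) (x y : ext_alg n B) : ext_alg n B :=
  [ffun K => \sum_(I in powerset K) (-1) ^+ inversions I (K :\: I) * x I * y (K :\: I)].

Section ExteriorAlgebra.
Context (n : nat) (B : pzRingType).
Implicit Types (I J K L : {set 'I_n}) (x y z : ext_alg n B).
Local Notation ext_alg := (ext_alg n B).
Local Notation ext_mul := (@ext_mul n B).

(* The monomial b y^I. *)
Definition ext_mon I (b : B) : ext_alg := [ffun K => if K == I then b else 0].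

Lemma ext_mulE x y K : ext_mul x y K =
  \sum_(I in powerset K) (-1) ^+ inversions I (K :\: I) * x I * y (K :\: I).
Proof. by rewrite ext_mul.unlock ffunE. Qed.

Lemma inversionsUl I J K : [disjoint I & J] ->
  inversions (I :|: J) K = (inversions I K + inversions J K)%N.
Proof.
move=> dIJ; rewrite /inversions -bigU /=; last exact: dIJ.
by apply: eq_bigl => i; rewrite !inE.
Qed.

Lemma inversionsUr I J K : [disjoint J & K] ->
  inversions I (J :|: K) = (inversions I J + inversions I K)%N.
Proof.
move=> dJK; rewrite /inversions -big_split; apply: eq_bigr => i _.
rewrite -bigU /=; last exact: dJK.
by apply: eq_bigl => j; rewrite !inE.
Qed.

Lemma inversions0l I : inversions set0 I = 0%N.
Proof. by rewrite /inversions big_set0. Qed.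

Lemma inversions0r I : inversions I set0 = 0%N.
Proof. by rewrite /inversions big1 // => i _; rewrite big_set0. Qed.

Lemma sign_comm k (b : B) : (-1) ^+ k * b = b * (-1) ^+ k.
Proof. by rewrite -signr_odd; case: odd; rewrite ?expr1 ?expr0 ?mul1r ?mulr1 ?mulN1r ?mulrN1. Qed.

Fact ext_mulA : associative ext_mul.
Proof.
move=> x y z; apply/ffunP=> K; rewrite !ext_mulE.
under eq_bigr => I _ do rewrite ext_mulE mulr_sumr.
under [RHS]eq_bigr => L _ do rewrite ext_mulE mulr_sumr mulr_suml.
rewrite [RHS](exchange_big_dep (mem (powerset K))) /=; last first.
  by move=> L I; rewrite !powersetE => LK IL; apply: subset_trans LK.
apply: eq_bigr => I; rewrite powersetE => IK.
rewrite [RHS](reindex_onto (fun J => I :|: J) (fun L => L :\: I)) /=; last first.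
  by move=> L; rewrite !powersetE => /andP[_ IL]; rewrite setDE setUIr setUCr setIT; apply/setUidPr.
have P J : (J \in powerset (K :\: I)) =
  [&& (I :|: J \in powerset K) && (I \in powerset (I :|: J)) & (I :|: J) :\: I == J].
  rewrite !powersetE subUset IK subsetUl /= andbT subsetD; congr (_ && _).
  rewrite setDUl setDv set0U; rewrite -setI_eq0 setDE.
  apply/eqP/eqP => [JI|<-]; last by rewrite -setIA [~: I :&: I]setIC setICr setI0.
  by apply/setIidPl; rewrite -disjoints_subset -setI_eq0 JI.
rewrite (eq_bigl _ _ P); apply: eq_bigr => J; rewrite -P powersetE => JKI.
have /andP[JK dJI] : (J \subset K) && [disjoint J & I] by rewrite -subsetD.
have dIJ : [disjoint I & J] by rewrite disjoint_sym.
have -> : (I :|: J) :\: I = J.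
  by rewrite setDUl setDv set0U; apply/setDidPl.
have -> : K :\: (I :|: J) = (K :\: I) :\: J by rewrite setDDl.
rewrite -{1}(setID (K :\: I) J) (setIidPr JKI).
rewrite (inversionsUr I); last by rewrite disjoint_sym disjoints_subset setDE subsetIr.
rewrite inversionsUl // !mulrA -(mulrA _ (x I)) -(sign_comm _ (x I)) !mulrA.
rewrite -!exprD; congr (_ ^+ _ * _ * _ * _); lia.
Qed.

Fact ext_mul1l : left_id (ext_mon set0 1) ext_mul.
Proof.
move=> x; apply/ffunP=> K; rewrite ext_mulE (bigD1 set0) ?powersetE ?sub0set //=.
rewrite !ffunE eqxx setD0 inversions0l expr0 !mul1r big1 ?addr0 // => I.
by case/andP=> _ /negbTE nI; rewrite ffunE nI mulr0 mul0r.
Qed.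

Fact ext_mul1r : right_id (ext_mon set0 1) ext_mul.
Proof.
move=> x; apply/ffunP=> K; rewrite ext_mulE (bigD1 K) ?powersetE //=.
rewrite !ffunE setDv eqxx inversions0r expr0 mul1r mulr1 big1 ?addr0 // => I.
rewrite powersetE => /andP[IK nIK]; rewrite ffunE setD_eq0 ifN ?mulr0 //.
by apply: contra nIK => KI; rewrite eqEsubset IK.
Qed.

Fact ext_mulDl : left_distributive ext_mul +%R.
Proof.
move=> x y z; apply/ffunP=> K; rewrite ffunE !ext_mulE -big_split; apply: eq_bigr => I _.
by rewrite ffunE mulrDr mulrDl.
Qed.

Fact ext_mulDr : right_distributive ext_mul +%R.
Proof.
move=> x y z; apply/ffunP=> K; rewrite ffunE !ext_mulE -big_split; apply: eq_bigr => I _.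
by rewrite ffunE mulrDr.
Qed.

HB.instance Definition _ := GRing.Zmodule_isPzRing.Build ext_alg
  ext_mulA ext_mul1l ext_mul1r ext_mulDl ext_mulDr.

Local Notation cst := (ext_mon set0).
Local Notation yext a := (ext_mon [set a] 1).

Lemma ext_mon_cstM b x K : (cst b * x) K = b * x K.
Proof.
rewrite [LHS]ext_mulE (bigD1 set0) ?powersetE ?sub0set //=.
rewrite !ffunE eqxx setD0 inversions0l expr0 !mul1r big1 ?addr0 // => I.
by case/andP=> _ /negbTE nI; rewrite ffunE nI mulr0 mul0r.
Qed.

Lemma ext_mon_Mcst x b K : (x * cst b) K = x K * b.
Proof.
rewrite [LHS]ext_mulE (bigD1 K) ?powersetE //=.
rewrite !ffunE setDv eqxx inversions0r expr0 mul1r big1 ?addr0 // => I.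
rewrite powersetE => /andP[IK nIK]; rewrite ffunE setD_eq0 ifN ?mulr0 //.
by apply: contra nIK => KI; rewrite eqEsubset IK.
Qed.

Lemma ext_mon_yM a x K : (yext a * x) K =
  if a \in K then (-1) ^+ inversions [set a] (K :\ a) * x (K :\ a) else 0.
Proof.
rewrite [LHS]ext_mulE; case: ifPn => [aK|naK].
  rewrite (bigD1 [set a]) ?powersetE ?sub1set //= ffunE eqxx mulr1 big1 ?addr0 // => I.
  by case/andP=> _ /negbTE nI; rewrite ffunE nI mulr0 mul0r.
rewrite big1 // => I; rewrite powersetE ffunE => IK.
case: eqP => [E|]; last by rewrite mulr0 mul0r.
by move: IK naK; rewrite E sub1set => ->.
Qed.

Lemma inversions1U a b L : b \notin L ->
  inversions [set a] (b |: L) = ((b < a) + inversions [set a] L)%N.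
Proof. by move=> nbL; rewrite /inversions !big_set1 big_setU1. Qed.

Lemma ext_yyM a b x : yext a * (yext b * x) = - (yext b * (yext a * x)).
Proof.
apply/ffunP=> K; rewrite [RHS]ffunE !ext_mon_yM !inE.
have [->|ab] := eqVneq b a; first by rewrite ?eqxx /= mulr0 !if_same oppr0.
rewrite ?(eq_sym a b) ?ab /=.
case aK: (a \in K); case bK: (b \in K); rewrite ?mulr0 ?oppr0 //.
have E : K :\ b :\ a = K :\ a :\ b by rewrite !setDDl setUC.
have E1 : inversions [set a] (K :\ a) = ((b < a) + inversions [set a] (K :\ a :\ b))%N.
  by rewrite -inversions1U ?setD1K // !inE ?eqxx // ab bK.
have E2 : inversions [set b] (K :\ b) = ((a < b) + inversions [set b] (K :\ a :\ b))%N.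
  by rewrite -inversions1U -E ?setD1K // !inE ?eqxx // eq_sym ab aK.
rewrite E E1 E2 !mulrA -!exprD -mulNr.
have /eqP/negbTE nab : a <> b :> nat by move/val_inj/esym/eqP; apply/negP.
congr (_ * _); case: ltngtP nab => //= _ _; rewrite ?add1n ?add0n ?addSn ?exprS ?mulN1r ?opprK.
  by rewrite addnC.
by rewrite addnC.
Qed.

Lemma ext_monE I b a : a \in I ->
  ext_mon I b = yext a * ext_mon (I :\ a) ((-1) ^+ inversions [set a] (I :\ a) * b).
Proof.
move=> aI; apply/ffunP=> K; rewrite ext_mon_yM !ffunE.
have [->|nKI] := eqVneq K I; first by rewrite aI eqxx signrMK.
case: ifP => // aK; case: eqP => [E|]; last by rewrite mulr0.
by case/eqP: nKI; rewrite -(setD1K aK) E setD1K.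
Qed.

Lemma ext_sum x : x = \sum_I ext_mon I (x I).
Proof.
apply/ffunP=> K; rewrite sum_ffunE (bigD1 K) //= ffunE eqxx big1 ?addr0 // => I nIK.
by rewrite ffunE eq_sym (negbTE nIK).
Qed.

Lemma ext_ind (P : ext_alg -> Prop) :
    (forall b, P (cst b)) -> (forall x y, P x -> P y -> P (x + y)) ->
    (forall a x, P x -> P (yext a * x)) ->
  forall x, P x.
Proof.
move=> Pc PD Py x; rewrite (ext_sum x).
have P0 : P 0.
  by rewrite (_ : 0 = cst 0) //; apply/ffunP=> K; rewrite !ffunE if_same.
apply: (big_ind P) => // I _; move: (x I); clear x.
elim: {I}_.+1 {-2}I (ltnSn #|I|) => // k IH I; rewrite ltnS => Ik b.
have [->|[a aI]] := set_0Vmem I; first exact: Pc.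
rewrite (ext_monE b aI); apply: Py; apply: IH.
by move: Ik; rewrite (cardsD1 a) aI.
Qed.

Definition parity_inv x : ext_alg := [ffun K : {set 'I_n} => (-1) ^+ #|K| * x K].

Lemma parity_invD x y : parity_inv (x + y) = parity_inv x + parity_inv y.
Proof. by apply/ffunP=> K; rewrite !ffunE mulrDr. Qed.

Lemma parity_inv_cst b : parity_inv (cst b) = cst b.
Proof.
by apply/ffunP=> K; rewrite !ffunE; case: eqP => [->|]; rewrite ?mulr0 // cards0 mul1r.
Qed.

Lemma parity_invK : involutive parity_inv.
Proof. by move=> x; apply/ffunP=> K; rewrite !ffunE signrMK. Qed.

Lemma parity_inv_y a x : parity_inv (yext a * x) = - (yext a * parity_inv x).
Proof.
apply/ffunP=> K; rewrite [LHS]ffunE [RHS]ffunE !ext_mon_yM; case: ifP => aK.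
  rewrite ffunE (cardsD1 a K) aK exprS mulN1r mulNr; congr (- _).
  by rewrite !mulrA -!exprD addnC.
by rewrite mulr0 oppr0.
Qed.

Lemma ext_y_cst a b : yext a * cst b = cst b * yext a.
Proof.
apply/ffunP=> K; rewrite ext_mon_Mcst ext_mon_cstM ffunE.
by case: ifP; rewrite ?mulr1 ?mul1r ?mulr0 ?mul0r.
Qed.

Lemma ext_yM_parity a x : yext a * x = parity_inv x * yext a.
Proof.
elim/ext_ind: x => [b|x y IHx IHy|b x IH].
- by rewrite parity_inv_cst ext_y_cst.
- by rewrite parity_invD mulrDl mulrDr IHx IHy.
by rewrite parity_inv_y mulNr -mulrA -IH ext_yyM.
Qed.

Definition contract a x : ext_alg :=
  [ffun K : {set 'I_n} => if a \in K then 0 else (-1) ^+ inversions [set a] K * x (a |: K)].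

Lemma contractD a x y : contract a (x + y) = contract a x + contract a y.
Proof.
by apply/ffunP=> K; rewrite !ffunE; case: ifP; rewrite ?addr0 // mulrDr.
Qed.

Lemma contract_cstM a b x : contract a (cst b * x) = cst b * contract a x.
Proof.
apply/ffunP=> K; rewrite ext_mon_cstM [LHS]ffunE ext_mon_cstM [contract a x K]ffunE.
case: ifP; rewrite ?mulr0 //.
by rewrite !mulrA sign_comm.
Qed.

Lemma contract_cst a b : contract a (cst b) = 0.
Proof.
apply/ffunP=> K; rewrite !ffunE; case: ifP => // aK; case: eqP => [/setP/(_ a)|].
  by rewrite !inE eqxx.
by rewrite mulr0.
Qed.

Lemma contract_yM a b x :
  contract a (yext b * x) = x *+ (a == b) - yext b * contract a x.
Proof.
apply/ffunP=> K.
rewrite [RHS]ffunE [X in _ = _ + X]ffunE ext_mon_yM [LHS]ffunE ext_mon_yM.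
rewrite [contract a x _]ffunE !inE eq_sym.
have [->|ab] := eqVneq b a.
  rewrite ?eqxx mulr1n /=; case: ifPn => aK.
    by rewrite signrMK setD1K // subrr.
  by rewrite setU1K // signrMK subr0.
rewrite mulr0n ffunE add0r /=; case: ifPn => aK; first by rewrite mulr0 if_same oppr0.
case: ifP => bK; rewrite ?oppr0 ?mulr0 //.
have nab : a != b by rewrite eq_sym.
have E : (a |: K) :\ b = a |: (K :\ b).
  by apply/setP=> i; rewrite !inE; case: (eqVneq i b) => // ->; rewrite (negbTE ab).
rewrite E inversions1U ?inE ?(negbTE aK) ?andbF //.
rewrite -{1}(setD1K bK) inversions1U ?inE ?eqxx //.
rewrite !mulrA -!exprD -mulNr.
have /eqP/negbTE nab' : a <> b :> nat by move/val_inj/eqP; apply/negP.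
congr (_ * _); case: ltngtP nab' => //= _ _; rewrite ?add1n ?add0n ?addSn ?addnS ?exprS ?mulN1r ?opprK.
  by rewrite addnC.
by rewrite addnC.
Qed.

Lemma contractM a x y :
  contract a (x * y) = contract a x * y + parity_inv x * contract a y.
Proof.
elim/ext_ind: x => [b|x x' IH IH'|b x IH].
- by rewrite contract_cstM contract_cst mul0r add0r parity_inv_cst.
- by rewrite mulrDl !contractD parity_invD !mulrDl IH IH' addrACA.
rewrite -mulrA !contract_yM IH parity_inv_y mulrDr mulrBl mulNr mulrnAl !mulrA.
by rewrite opprD addrA.
Qed.

Definition map_coef (h : B -> B) x : ext_alg := [ffun K => h (x K)].

Lemma map_coefE h x K : map_coef h x K = h (x K).
Proof. by rewrite ffunE. Qed.

Lemma map_coefD h x y : {morph h : b c / b + c} ->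
  map_coef h (x + y) = map_coef h x + map_coef h y.
Proof. by move=> hD; apply/ffunP=> K; rewrite !ffunE hD. Qed.

Lemma map_coef_cst h b : h 0 = 0 -> map_coef h (cst b) = cst (h b).
Proof. by move=> h0; apply/ffunP=> K; rewrite !ffunE; case: ifP; rewrite ?h0. Qed.

Lemma map_coefM h x y : {morph h : b c / b + c} ->
    (forall b c, h (b * c) = h b * c + b * h c) ->
  map_coef h (x * y) = map_coef h x * y + x * map_coef h y.
Proof.
move=> hD hM.
have h0 : h 0 = 0 by apply: (@addIr _ (h 0)); rewrite -hD !add0r.
have hN b : h (- b) = - h b by apply: (@addIr _ (h b)); rewrite -hD !addNr h0.
apply/ffunP=> K; rewrite [LHS]ffunE [RHS]ffunE !ext_mulE (big_morph _ hD h0).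
rewrite -big_split; apply: eq_bigr => I _ /=.
rewrite -!mulrA -(signr_odd _ (inversions _ _)) !mulr_sign !map_coefE.
by case: odd; rewrite ?hN hM ?opprD.
Qed.

End ExteriorAlgebra.

(* The tensor product algebra  S g^* (x) /\ g^* (x) End V  in the generators    *)
(* v^a, y^a: the coefficients of the exterior algebra are taken in             *)
(* S g^* (x) End V, represented by the square matrices of size dim V over the  *)
(* polynomial ring in the v^a; an endomorphism of V is represented by its       *)
(* matrix (with constant entries) in the basis vbasis {:V}.                     *)
Section CovariantWeilAlgebra.
Context (R : realType) (n : nat) (V : vectType R).
Implicit Types (a b : 'I_n) (A : 'End(V)) (I J K : {set 'I_n}).

Definition cov_weil := ext_alg n 'M[{mpoly R[n]}]_(\dim {:V}).

Implicit Types (x y z : cov_weil).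

HB.instance Definition _ := GRing.PzRing.copy cov_weil
  (ext_alg n 'M[{mpoly R[n]}]_(\dim {:V})).

Definition cov_weil_scale (c : R) x : cov_weil := [ffun I => c%:MP *: x I].

Fact cov_weil_scaleA c d x :
  cov_weil_scale c (cov_weil_scale d x) = cov_weil_scale (c * d) x.
Proof. by apply/ffunP=> I; rewrite !ffunE scalerA mpolyCM. Qed.

Fact cov_weil_scale1 : left_id 1 cov_weil_scale.
Proof. by move=> x; apply/ffunP=> I; rewrite ffunE mpolyC1 scale1r. Qed.

Fact cov_weil_scaleDr : right_distributive cov_weil_scale +%R.
Proof. by move=> c x y; apply/ffunP=> I; rewrite !ffunE scalerDr. Qed.

Fact cov_weil_scaleDl x : {morph cov_weil_scale^~ x : c d / c + d}.
Proof. by move=> c d; apply/ffunP=> I; rewrite !ffunE mpolyCD scalerDl. Qed.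

HB.instance Definition _ := GRing.Zmodule_isLmodule.Build R cov_weil
  cov_weil_scaleA cov_weil_scale1 cov_weil_scaleDr cov_weil_scaleDl.

Lemma cov_weil_scaleAl (c : R) x y : c *: (x * y) = (c *: x) * y.
Proof.
apply/ffunP=> K; rewrite ffunE !ext_mulE scaler_sumr; apply: eq_bigr => I _.
by rewrite ffunE -!mulmxE scalemxAl scalemxAr.
Qed.

Lemma cov_weil_scaleAr (c : R) x y : c *: (x * y) = x * (c *: y).
Proof.
apply/ffunP=> K; rewrite ffunE !ext_mulE scaler_sumr; apply: eq_bigr => I _.
by rewrite ffunE -!mulmxE scalemxAr.
Qed.

Definition vgen a : cov_weil := ext_mon set0 ('X_a)%:M.

Definition ygen a : cov_weil := ext_mon [set a] 1.

Definition endgen A : cov_weil :=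
  ext_mon set0 (\matrix_(i, j) (coord (vbasis {:V}) i (A (vbasis {:V})`_j))%:MP).

(* deg v^a = 2, deg y^a = 1, deg A = 0.                                        *)
Definition homogeneous (k : nat) x :=
  forall I i j m, (x I i j)@_m != 0 -> (2 * mdeg m + #|I|)%N = k.

(* [x, y] = x y - (-1)^(|x| |y|) y x on homogeneous elements, extended           *)
(* bilinearly; parity_part true is the odd part.                               *)
Definition parity_part (p : bool) x : cov_weil :=
  [ffun I : {set 'I_n} => if odd #|I| == p then x I else 0].

Definition supercomm x y : cov_weil :=
  \sum_(p : bool) \sum_(q : bool)
    (parity_part p x * parity_part q y
     - (-1) ^+ (p && q) * (parity_part q y * parity_part p x)).

Definition graded_derivation1 (d : cov_weil -> cov_weil) :=
  [/\ linear d,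
      forall k x, homogeneous k x -> homogeneous k.+1 (d x) &
      forall k x y, homogeneous k x -> d (x * y) = d x * y + (-1) ^+ k * x * d y].

(* f j k a stands for f_{jk}^a, and t a for tau(e_a). *)
Definition is_covariant_differential (f : 'I_n -> 'I_n -> 'I_n -> R)
    (t : 'I_n -> 'End(V)) (d : cov_weil -> cov_weil) :=
  [/\ graded_derivation1 d,
      forall a, d (ygen a) =
        vgen a - 2^-1 *: \sum_j \sum_k f j k a *: (ygen j * ygen k),
      forall a, d (vgen a) = - \sum_j \sum_k f j k a *: (ygen j * vgen k) &
      forall A, d (endgen A) = \sum_a ygen a * endgen ((t a \o A) - (A \o t a))%VF].

Definition curvature (t : 'I_n -> 'End(V)) : cov_weil := \sum_a vgen a * endgen (t a).

Local Notation cst := (@ext_mon n _ set0).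
Local Notation mat A :=
  (\matrix_(i, j) (coord (vbasis {:V}) i (A (vbasis {:V})`_j))%:MP : 'M[{mpoly R[n]}]_(\dim {:V})).

Lemma ext_mon_cstB (B : pzRingType) (b c : B) : cst (b - c) = cst b - cst c.
Proof. by apply/ffunP=> K; rewrite !ffunE; case: ifP; rewrite ?subr0. Qed.

Lemma ext_mon_cstD (B : pzRingType) (b c : B) : cst (b + c) = cst b + cst c.
Proof. by apply/ffunP=> K; rewrite !ffunE; case: ifP; rewrite ?addr0. Qed.

Lemma ext_mon_cst0 (B : pzRingType) : cst (0 : B) = 0.
Proof. by apply/ffunP=> K; rewrite !ffunE if_same. Qed.

Lemma ext_mon_cstMM (B : pzRingType) (b c : B) : cst (b * c) = cst b * cst c.
Proof.
by apply/ffunP=> K; rewrite ext_mon_cstM !ffunE; case: ifP; rewrite ?mulr0.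
Qed.

Lemma mat_comp A A' : mat (A \o A')%VF = mat A * mat A'.
Proof.
apply/matrixP=> i j; rewrite !mxE comp_lfunE.
rewrite {1}(coord_vbasis (memvf (A' _))) !linear_sum /=.
rewrite raddf_sum /=; apply: eq_bigr => k _.
by rewrite !mxE linearZ /= linearZ /= mpolyCM mulrC.
Qed.

Lemma endgenM A A' : endgen (A \o A')%VF = endgen A * endgen A'.
Proof. by rewrite /endgen mat_comp ext_mon_cstMM. Qed.

Lemma endgenB A A' : endgen (A - A') = endgen A - endgen A'.
Proof.
rewrite /endgen -ext_mon_cstB; congr (cst _).
by apply/matrixP=> i j; rewrite !mxE !lfunE /= lfunE linearB /= mpolyCB.
Qed.

Lemma endgen1 : endgen \1%VF = 1.
Proof.
rewrite /endgen; congr (cst _); apply/matrixP=> i j; rewrite !mxE lfunE /=.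
by rewrite coord_free ?(basis_free (vbasisP _)) // eq_sym; case: eqP; rewrite ?mpolyC0 ?mpolyC1.
Qed.

Lemma endgen_mx (N : 'M[R]_(\dim {:V})) :
  exists A, endgen A = cst (map_mx (@mpolyC n R) N).
Proof.
exists (passmx.hommx (vbasis {:V}) (vbasis {:V}) N^T); congr (cst _).
apply/matrixP=> i j; rewrite !mxE.
have bV := vbasisP {:V}; move: (passmx.hommxK bV bV N^T).
move/matrixP/(_ j i); rewrite !mxE /= => <-; congr (_%:MP).
by rewrite passmx.vecof_delta.
Qed.

Lemma vgenC a x : vgen a * x = x * vgen a.
Proof. by apply/ffunP=> K; rewrite ext_mon_cstM ext_mon_Mcst -!mulmxE scalar_mxC. Qed.

Lemma ygen_vgen a b : ygen a * vgen b = vgen b * ygen a.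
Proof. exact: ext_y_cst. Qed.

Lemma ygen_endgen a A : ygen a * endgen A = endgen A * ygen a.
Proof. exact: ext_y_cst. Qed.

Lemma ygenN a b : ygen a * ygen b = - (ygen b * ygen a).
Proof. by have := ext_yyM a b (1 : cov_weil); rewrite !mulr1. Qed.

Lemma ygen_sq a : ygen a * ygen a = 0.
Proof.
apply/ffunP=> K; rewrite ext_mon_yM !ffunE; case: ifP => // _.
by case: eqP => [/setP/(_ a)|]; rewrite ?mulr0 // !inE eqxx.
Qed.

Lemma cov_weil_ind (P : cov_weil -> Prop) :
    (forall A, P (endgen A)) -> (forall x y, P x -> P y -> P (x + y)) ->
    (forall a x, P x -> P (vgen a * x)) -> (forall a x, P x -> P (ygen a * x)) ->
  forall x, P x.
Proof.
move=> Pe PD Pv Py; apply: ext_ind => // M.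
have Ps (I : finType) (F : I -> 'M_(\dim {:V})) :
    (forall i, P (cst (F i))) -> P (cst (\sum_i F i)).
  move=> PF; apply: (big_ind (fun N => P (cst N))) => // [|N N' PN PN'].
    by have [A EA] := endgen_mx 0; rewrite map_mx0 in EA; rewrite -EA.
  by rewrite ext_mon_cstD; apply: PD.
rewrite (matrix_sum_delta M); apply: (Ps _ (fun i => _)) => i.
apply: (Ps _ (fun j => _)) => j.
elim/mpolyind: (M i j) => [|c m p _ _ IH].
  by rewrite scale0r; have [A EA] := endgen_mx 0; rewrite map_mx0 in EA; rewrite -EA.
rewrite scalerDl ext_mon_cstD; apply: PD => // {IH}.
elim: {m}(mdeg m) {-2}m (erefl (mdeg m)) => [|k IH] m.
  move/eqP; rewrite mdeg_eq0 => /eqP ->; rewrite mpolyX0.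
  have [A EA] := endgen_mx (c *: delta_mx i j).
  move: EA; rewrite map_mxZ /= map_delta_mx => EA.
  by rewrite -mul_mpolyC mulr1 -EA.
move=> mk; have /eqP/mnmP nz : m != 0%MM by rewrite -mdeg_eq0 mk.
have [l ml] : exists l, m l != 0%N.
  apply/existsP; apply: contraT; rewrite negb_exists => /forallP m0.
  by case: nz => l; rewrite mnm0E; apply/eqP; move: (m0 l); rewrite negbK.
have Em : m = (U_(l) + (m - U_(l)))%MM by rewrite addmC submK // lep1mP.
rewrite Em mpolyXD scalerAr -scalerA -mul_scalar_mx ext_mon_cstMM.
apply: Pv; apply: IH; apply/eqP; rewrite -eqSS -mk {2}Em mdegD mdeg1.
by rewrite add1n.
Qed.

(* Degree bookkeeping: x is homogeneous of degree k - s.                       *)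
Definition phom (s k : nat) (p : {mpoly R[n]}) := forall m, p@_m != 0 -> (2 * mdeg m + s)%N = k.
Definition whom (s k : nat) x := forall I i j, phom (s + #|I|) k (x I i j).

Lemma homogeneousE k x : homogeneous k x <-> whom 0 k x.
Proof. by []. Qed.

Lemma phom0 s k : phom s k 0.
Proof. by move=> m; rewrite mcoeff0 eqxx. Qed.

Lemma phomD s k p q : phom s k p -> phom s k q -> phom s k (p + q).
Proof.
move=> hp hq m; rewrite mcoeffD; case: (eqVneq p@_m 0) => [->|/hp //].
by rewrite add0r => /hq.
Qed.

Lemma phomN s k p : phom s k p -> phom s k (- p).
Proof. by move=> hp m; rewrite mcoeffN oppr_eq0 => /hp. Qed.

Lemma phom_sum s k (I : finType) (P : pred I) (F : I -> {mpoly R[n]}) :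
  (forall i, P i -> phom s k (F i)) -> phom s k (\sum_(i | P i) F i).
Proof. by move=> hF; apply: big_ind => //; [apply: phom0|apply: phomD]. Qed.

Lemma phomM s k s' k' p q : phom s k p -> phom s' k' q ->
  phom (s + s') (k + k') (p * q).
Proof.
move=> hp hq m; rewrite -mcoeff_msupp => /msuppM_le /allpairsP[[m1 m2] /= [h1 h2 ->]].
rewrite !mcoeff_msupp in h1 h2; rewrite -(hp _ h1) -(hq _ h2) mdegD; lia.
Qed.

Lemma phomC c : phom 0 0 c%:MP.
Proof.
move=> m; rewrite mcoeffC; case: (eqVneq m 0%MM) => [->|]; last by rewrite mulr0 eqxx.
by rewrite mdeg0.
Qed.

Lemma phomX a : phom 0 2 'X_a.
Proof. by move=> m; rewrite mcoeffX; case: (eqVneq U_(a)%MM m) => [<- _|_]; rewrite ?eqxx // mdeg1. Qed.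

Lemma phom_deriv s k a p : phom s k p -> phom (2 + s) k p^`M(a).
Proof.
move=> hp m; rewrite mcoeff_deriv => h.
have /hp <- : p@_(m + U_(a)) != 0 by apply: contraNneq h => ->; rewrite mul0rn.
by rewrite mdegD mdeg1; lia.
Qed.

Lemma whomD s k x y : whom s k x -> whom s k y -> whom s k (x + y).
Proof. by move=> hx hy I i j; rewrite ffunE mxE; apply: phomD. Qed.

Lemma whom0 s k : whom s k 0.
Proof. by move=> I i j; rewrite ffunE mxE; apply: phom0. Qed.

Lemma whomN s k x : whom s k x -> whom s k (- x).
Proof. by move=> hx I i j; rewrite ffunE mxE; apply: phomN. Qed.

Lemma whom_sum s k (I : finType) (F : I -> cov_weil) :
  (forall i, whom s k (F i)) -> whom s k (\sum_i F i).
Proof. by move=> hF; apply: big_ind => //; [apply: whom0|apply: whomD]. Qed.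

Lemma whomZ s k c x : whom s k x -> whom s k (c *: x).
Proof.
by move=> hx I i j; rewrite ffunE mxE; exact: (phomM (@phomC c) (hx I i j)).
Qed.

Lemma whomM s k s' k' x y : whom s k x -> whom s' k' y ->
  whom (s + s') (k + k') (x * y).
Proof.
move=> hx hy K i j; rewrite ext_mulE summxE; apply: phom_sum => I.
rewrite powersetE => IK; rewrite -!mulmxE.
have -> : (s + s' + #|K| = (s + #|I|) + (s' + #|K :\: I|))%N.
  by rewrite cardsD (setIidPr IK); have := subset_leq_card IK; lia.
rewrite mulmxE -mulrA -signr_odd mulr_sign.
have h : phom (s + #|I| + (s' + #|K :\: I|)) (k + k') ((x I * y (K :\: I)) i j).
  by rewrite -mulmxE mxE; apply: phom_sum => l _; apply: phomM.
by case: odd => //; rewrite mxE; apply: phomN.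
Qed.

Lemma vgen_homogeneous a : homogeneous 2 (vgen a).
Proof.
move=> I i j; rewrite ffunE; case: eqP => [->|_]; last by rewrite mxE; apply: phom0.
rewrite cards0 mxE; case: eqP => _; first exact: phomX.
exact: phom0.
Qed.

Lemma ygen_homogeneous a : homogeneous 1 (ygen a).
Proof.
move=> I i j; rewrite ffunE; case: eqP => [->|_]; last by rewrite mxE; apply: phom0.
rewrite cards1 mxE => m; rewrite mcoeffMn mcoeff1.
by case: (eqVneq m 0%MM) => [->|]; [rewrite mdeg0|rewrite mul0rn eqxx].
Qed.

Lemma endgen_homogeneous A : homogeneous 0 (endgen A).
Proof.
move=> I i j; rewrite ffunE; case: eqP => [->|_]; last by rewrite mxE; apply: phom0.
by rewrite cards0 mxE; apply: phomC.
Qed.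

Lemma curvature_homogeneous t : homogeneous 2 (curvature t).
Proof.
apply/homogeneousE; apply: whom_sum => a; apply: (@whomM 0 2 0 0); apply/homogeneousE.
  exact: vgen_homogeneous.
exact: endgen_homogeneous.
Qed.

Lemma supercomm_even k x y : ~~ odd k -> homogeneous k x ->
  supercomm x y = x * y - y * x.
Proof.
move=> k_even hx.
have x1 : parity_part true x = 0.
  apply/ffunP=> I; rewrite !ffunE; case: eqP => // oI; apply/matrixP=> i j.
  rewrite !mxE; apply/mpolyP=> m; rewrite mcoeff0; apply/eqP; apply: contraT => /hx E.
  by move: k_even; rewrite -E oddD oddM oI.
have sumP z : parity_part true z + parity_part false z = z.
  by apply/ffunP=> I; rewrite !ffunE; case: odd; rewrite ?addr0 ?add0r.
have x0 : parity_part false x = x by rewrite -[RHS]sumP x1 add0r.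
rewrite /supercomm !big_bool /= x1 x0 !mul0r !mulr0 !subrr !add0r !expr0 !mul1r.
by rewrite addrACA -opprD -mulrDl -mulrDr sumP.
Qed.

Lemma covariant_differential_uniq f t d d' :
  is_covariant_differential f t d -> is_covariant_differential f t d' -> d =1 d'.
Proof.
move=> [[dL _ dM] dy dv dA] [[dL' _ dM'] dy' dv' dA']; apply: cov_weil_ind.
- by move=> A; rewrite dA dA'.
- by move=> x y IHx IHy; have := dL 1 x y; have := dL' 1 x y; rewrite !scale1r IHx IHy => -> ->.
- move=> a x IH; rewrite (dM _ _ _ (@vgen_homogeneous a)) (dM' _ _ _ (@vgen_homogeneous a)).
  by rewrite dv dv' IH.
move=> a x IH; rewrite (dM _ _ _ (@ygen_homogeneous a)) (dM' _ _ _ (@ygen_homogeneous a)).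
by rewrite dy dy' IH.
Qed.

Section Existence.
Context (f : 'I_n -> 'I_n -> 'I_n -> R) (t : 'I_n -> 'End(V)).

(* y^a lie_der a is the part of the differential that acts on the coefficients *)
(* (the coadjoint action on S g^* and the adjoint action on End V), and        *)
(* y_value a is the prescribed value of the differential on y^a.               *)
Definition sym_der a (p : {mpoly R[n]}) : {mpoly R[n]} :=
  - \sum_b \sum_k (f a k b)%:MP * ('X_k * p^`M(b)).

Definition coef_der a (M : 'M[{mpoly R[n]}]_(\dim {:V})) :=
  map_mx (sym_der a) M + (mat (t a) *m M - M *m mat (t a)).

Definition lie_der a x : cov_weil := map_coef (coef_der a) x.

Definition y_value a : cov_weil :=
  vgen a - 2^-1 *: \sum_j \sum_k f j k a *: (ygen j * ygen k).

Definition cov_diff x : cov_weil :=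
  \sum_a (ygen a * lie_der a x + y_value a * contract a x).

Lemma sym_derD a p q : sym_der a (p + q) = sym_der a p + sym_der a q.
Proof.
rewrite /sym_der -opprD; congr (- _); rewrite -big_split; apply: eq_bigr => b _.
rewrite -big_split; apply: eq_bigr => k _ /=.
by rewrite mderivD !mulrDr.
Qed.

Lemma sym_der0 a : sym_der a 0 = 0.
Proof. by apply: (@addIr _ (sym_der a 0)); rewrite -sym_derD !add0r. Qed.

Lemma sym_derN a p : sym_der a (- p) = - sym_der a p.
Proof. by apply: (@addIr _ (sym_der a p)); rewrite -sym_derD !addNr sym_der0. Qed.

Lemma sym_der_sum a (I : finType) (F : I -> {mpoly R[n]}) :
  sym_der a (\sum_i F i) = \sum_i sym_der a (F i).
Proof. exact: (big_morph _ (sym_derD a) (sym_der0 a)). Qed.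

Lemma sym_derM a p q : sym_der a (p * q) = sym_der a p * q + p * sym_der a q.
Proof.
rewrite /sym_der mulNr mulrN -opprD; congr (- _).
rewrite mulr_suml mulr_sumr -big_split; apply: eq_bigr => b _ /=.
rewrite mulr_suml mulr_sumr -big_split; apply: eq_bigr => k _ /=.
by rewrite mderivM; ring.
Qed.

Lemma sym_derC a c : sym_der a c%:MP = 0.
Proof.
rewrite /sym_der big1 ?oppr0 // => b _; rewrite big1 // => k _.
by rewrite mderivC !mulr0.
Qed.

Lemma coef_derD a M N : coef_der a (M + N) = coef_der a M + coef_der a N.
Proof.
rewrite /coef_der mulmxDr mulmxDl opprD [RHS]addrACA.
rewrite [X in _ = _ + X]addrACA; congr (_ + _).
by apply/matrixP=> i j; rewrite !mxE sym_derD.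
Qed.

Lemma coef_der0 a : coef_der a 0 = 0.
Proof. by apply: (@addIr _ (coef_der a 0)); rewrite -coef_derD !add0r. Qed.

Lemma coef_derN a M : coef_der a (- M) = - coef_der a M.
Proof. by apply: (@addIr _ (coef_der a M)); rewrite -coef_derD !addNr coef_der0. Qed.

Lemma coef_derM a M N : coef_der a (M * N) = coef_der a M * N + M * coef_der a N.
Proof.
rewrite -!mulmxE /coef_der mulmxDl mulmxDr mulmxBl mulmxBr !mulmxA.
rewrite addrACA; congr (_ + _); last by rewrite addrA subrK.
apply/matrixP=> i j; rewrite !mxE sym_der_sum -big_split; apply: eq_bigr => k _ /=.
by rewrite sym_derM !mxE.
Qed.

Lemma coef_derC a p : coef_der a p%:M = (sym_der a p)%:M.
Proof.
rewrite /coef_der scalar_mxC subrr addr0; apply/matrixP=> i j; rewrite !mxE.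
by case: eqP => _; rewrite ?mulr1n ?mulr0n ?sym_der0.
Qed.

Lemma lie_derD a x y : lie_der a (x + y) = lie_der a x + lie_der a y.
Proof. exact: (map_coefD x y (coef_derD a)). Qed.

Lemma lie_derM a x y : lie_der a (x * y) = lie_der a x * y + x * lie_der a y.
Proof. exact: (map_coefM x y (coef_derD a) (coef_derM a)). Qed.

Lemma lie_der_cst a M : lie_der a (cst M) = cst (coef_der a M).
Proof. by apply: map_coef_cst; apply: coef_der0. Qed.

Lemma lie_der_y a b : lie_der a (ygen b) = 0.
Proof.
apply/ffunP=> K; rewrite !ffunE; case: eqP => _; rewrite ?coef_der0 //.
by rewrite coef_derC -mpolyC1 sym_derC; apply/matrixP=> i j; rewrite !mxE mul0rn.
Qed.

Lemma y_valueC a x : y_value a * x = x * y_value a.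
Proof.
rewrite /y_value mulrBl mulrBr vgenC -cov_weil_scaleAl -cov_weil_scaleAr.
congr (_ - _ *: _); rewrite mulr_suml mulr_sumr; apply: eq_bigr => j _.
rewrite mulr_suml mulr_sumr; apply: eq_bigr => k _.
rewrite -cov_weil_scaleAl -cov_weil_scaleAr; congr (_ *: _).
rewrite -mulrA [ygen k * x]ext_yM_parity !mulrA.
by rewrite [ygen j * parity_inv x]ext_yM_parity parity_invK.
Qed.

Lemma cov_diffM x y : cov_diff (x * y) = cov_diff x * y + parity_inv x * cov_diff y.
Proof.
rewrite /cov_diff mulr_suml mulr_sumr -big_split; apply: eq_bigr => a _ /=.
move: (y_value a) (y_valueC a (parity_inv x)) => w wC.
rewrite lie_derM contractM !mulrDr mulrDl !mulrA wC.
have -> : ygen a * x = parity_inv x * ygen a by exact: ext_yM_parity.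
by rewrite addrACA.
Qed.

Lemma cov_diffD x y : cov_diff (x + y) = cov_diff x + cov_diff y.
Proof.
rewrite /cov_diff -big_split; apply: eq_bigr => a _ /=.
by rewrite lie_derD contractD !mulrDr addrACA.
Qed.

Lemma cov_diff_cst M : cov_diff (cst M) = \sum_a ygen a * cst (coef_der a M).
Proof. by apply: eq_bigr => a _; rewrite lie_der_cst contract_cst mulr0 addr0. Qed.

Lemma cov_diffZ c x : cov_diff (c *: x) = c *: cov_diff x.
Proof.
have E z : c *: z = cst (c%:MP%:M) * z.
  by apply/ffunP=> K; rewrite ext_mon_cstM ffunE -mulmxE mul_scalar_mx.
rewrite [in LHS]E cov_diffM parity_inv_cst -E cov_diff_cst big1 ?mul0r ?add0r // => a _.
rewrite coef_derC sym_derC (_ : 0%:M = 0) ?ext_mon_cst0 ?mulr0 //.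
by apply/matrixP=> i j; rewrite !mxE mul0rn.
Qed.

Lemma cov_diff_y a : cov_diff (ygen a) = y_value a.
Proof.
rewrite /cov_diff (bigD1 a) //= big1 ?addr0 => [|b /negbTE ba].
  rewrite lie_der_y mulr0 add0r -[ygen a]mulr1 contract_yM eqxx mulr1n.
  by rewrite contract_cst mulr0 subr0 mulr1.
rewrite lie_der_y mulr0 add0r -[ygen a]mulr1 contract_yM ba mulr0n.
by rewrite contract_cst mulr0 subr0 mulr0.
Qed.

Lemma cov_diff_v a : cov_diff (vgen a) =
  - \sum_j \sum_k f j k a *: (ygen j * vgen k).
Proof.
rewrite cov_diff_cst -sumrN; apply: eq_bigr => j _.
rewrite coef_derC -sumrN.
have -> : sym_der j 'X_a = - \sum_k (f j k a)%:MP * 'X_k.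
  rewrite /sym_der (bigD1 a) //= [X in _ + X]big1 ?addr0 => [|b ba].
    congr (- _); apply: eq_bigr => k _.
    rewrite mderivX mnmE eqxx scale1r (_ : (_ - _)%MM = 0%MM) ?mpolyX0 ?mulr1 //.
    by apply/mnmP=> i; rewrite !mnmE subnn.
  by rewrite big1 // => k _; rewrite mderivX mnmE (eq_sym a) (negbTE ba) scale0r !mulr0.
have cstX c k : cst ((c%:MP * 'X_k)%:M : 'M_(\dim {:V})) = c *: vgen k.
  apply/ffunP=> K; rewrite !ffunE -scale_scalar_mx.
  by case: ifP => _ //; rewrite scaler0.
have cstD : {morph (fun p : {mpoly R[n]} => cst (p%:M : 'M_(\dim {:V}))) : p q / p + q}.
  by move=> p q; rewrite raddfD ext_mon_cstD.
have cst0 : cst ((0 : {mpoly R[n]})%:M : 'M_(\dim {:V})) = 0.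
  by rewrite raddf0 ext_mon_cst0.
have -> : cst ((- \sum_k (f j k a)%:MP * 'X_k)%:M : 'M_(\dim {:V})) =
    - \sum_k f j k a *: vgen k.
  rewrite raddfN -[- _%:M]sub0r ext_mon_cstB ext_mon_cst0 sub0r; congr (- _).
  by rewrite (big_morph _ cstD cst0); apply: eq_bigr => k _; apply: cstX.
by rewrite mulrN mulr_sumr -sumrN; apply: eq_bigr => k _; rewrite cov_weil_scaleAr.
Qed.

Lemma cov_diff_end A : cov_diff (endgen A) =
  \sum_a ygen a * endgen ((t a \o A) - (A \o t a))%VF.
Proof.
rewrite cov_diff_cst; apply: eq_bigr => a _; congr (_ * _).
rewrite endgenB !endgenM /endgen -!ext_mon_cstMM -ext_mon_cstB; congr (cst _).
rewrite /coef_der (_ : map_mx _ _ = 0) ?add0r //.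
by apply/matrixP=> i j; rewrite !mxE sym_derC.
Qed.

Lemma cov_diff_homogeneous k x : homogeneous k x -> homogeneous k.+1 (cov_diff x).
Proof.
move=> hx; apply/homogeneousE; apply: whom_sum => a; apply: whomD.
  apply: (@whomM 0 1 0 k); first exact/homogeneousE/ygen_homogeneous.
  move=> K i j; rewrite ffunE /coef_der !mxE.
  apply: phomD; first (apply: phomN; apply: phom_sum => b _; apply: phom_sum => l _).
    have hd := @phom_deriv _ _ b _ (hx K i j).
    have := phomM (@phomC (f a l b)) (phomM (@phomX l) hd).
    by move=> h m /h; lia.
  apply: phomD; last apply: phomN; apply: phom_sum => l _; rewrite mxE.
    exact: (phomM (@phomC _) (hx K l j)).
  by have := phomM (hx K i l) (@phomC (coord (vbasis {:V}) l (t a (vbasis {:V})`_j))); rewrite !addn0.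
have hy : whom 0 2 (y_value a).
  apply: whomD; first exact/homogeneousE/vgen_homogeneous.
  apply: whomN; apply: whomZ; apply: whom_sum => j; apply: whom_sum => l; apply: whomZ.
  by apply: (@whomM 0 1 0 1); apply/homogeneousE/ygen_homogeneous.
have hc : whom 1 k (contract a x).
  move=> K i j; rewrite ffunE; case: ifPn => aK; first by rewrite mxE; apply: phom0.
  rewrite -signr_odd mulr_sign; have := hx (a |: K) i j; rewrite cardsU1 aK => h.
  by case: odd => //; rewrite mxE; apply: phomN.
by move=> K i j m /(whomM hy hc); lia.
Qed.

Lemma cov_diffP : is_covariant_differential f t cov_diff.
Proof.
split; last exact: cov_diff_end; last exact: cov_diff_v; last exact: cov_diff_y.
split; last 1 first.
- move=> k x y hx; rewrite cov_diffM; congr (_ + _ * _).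
  apply/ffunP=> K; rewrite ffunE.
  have -> : (-1) ^+ k * x = (-1) ^+ k *: x.
    by rewrite -signr_odd mulr_sign -[in RHS]signr_odd scaler_sign.
  rewrite ffunE -signr_odd mulr_sign; apply/matrixP=> i j; apply/mpolyP=> m.
  have [z|/hx E] := eqVneq (x K i j)@_m 0.
    by case: odd; rewrite !mxE ?mcoeffN mcoeffCM z ?oppr0 mulr0.
  rewrite mxE mcoeffCM -E -[(-1) ^+ _ in RHS]signr_odd oddD oddM /=.
  by case: odd; rewrite ?mxE ?mcoeffN ?expr1 ?expr0 ?mulN1r ?mul1r.
- by move=> c x y; rewrite cov_diffD cov_diffZ.
exact: cov_diff_homogeneous.
Qed.

End Existence.

Lemma covariant_differential_exists f t : exists d, is_covariant_differential f t d.
Proof. by exists (cov_diff f t); exact: cov_diffP. Qed.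

End CovariantWeilAlgebra.

(* Main.v *)
Require Import Defs.
From HB Require Import structures.
From mathcomp Require Import all_boot all_order all_algebra reals.
From mathcomp Require Import mpoly ring.

Set Implicit Arguments.
Unset Strict Implicit.
Unset Printing Implicit Defensive.

Import GRing.Theory Num.Theory.
Local Open Scope ring_scope.

(** The difference of the two sides of the identity, d o d - [C, -], is a
    derivation: C is even, and the square of an odd derivation is an even
    derivation, because the cross terms dx dz cancel.  It therefore vanishes as
    soon as it vanishes on the generators v^a, y^a and on End V.

    C commutes with v^a and y^a, so on these generators the claim is d d = 0
    ([covd2_v], [covd2_y]).  Expanding d d v^a gives a term in v^j v^k, which
    dies by antisymmetry of f_{jk}^a, and terms in y^l y^m v^k whose
    coefficient, antisymmetrized in l and m, vanishes by the Jacobi identity.  In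
    d d y^a the terms in y^j v^k cancel and the cubic term in y, summed over
    cyclic permutations of its three indices, vanishes for the same reason.

    On an endomorphism A ([covd2_end]),
      d d A = v^a [tau_a, A] - 1/2 f_{jk}^a y^j y^k [tau_a, A]
              - y^j y^k [tau_k, [tau_j, A]].
    The first term is [C, A].  As tau is a representation, f_{jk}^a [tau_a, A]
    is [tau_j, [tau_k, A]] - [tau_k, [tau_j, A]], so the two other terms add up
    to -1/2 y^j y^k times an expression symmetric in j and k, which is 0. *)

(** * Sums with symmetry *)

(** The Jacobi identity for the commutators with a, b and x: commutation with
    [a, b] is the commutator of the commutations with a and with b. *)
Lemma commutator_jacobi (A : pzRingType) (a b x : A) :
  (a * b - b * a) * x - x * (a * b - b * a)
  = (a * (b * x - x * b) - (b * x - x * b) * a)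
    - (b * (a * x - x * a) - (a * x - x * a) * b).
Proof.
rewrite !(mulrBl, mulrBr) !mulrA.
move: (a * b * x) (b * a * x) (x * a * b) (x * b * a) (a * x * b) (b * x * a).
move=> p u w s q r.
rewrite [in RHS](opprB (u - r)) [RHS]addrACA [p - q + _]addrA subrK.
rewrite -opprD [r - s + _]addrC [u - r + _]addrA subrK.
by rewrite !opprD !opprK addrACA.
Qed.

Section SymmetrySums.
Context (R : realType) (U : lmodType R) (I : finType).

Lemma mulrSn_eq0 k (x : U) : x *+ k.+1 = 0 -> x = 0.
Proof.
by rewrite -scaler_nat => /eqP; rewrite scaler_eq0 pnatr_eq0 /= => /eqP.
Qed.

(** Replaces half of an antisymmetric expression by its symmetrization, when z
    is x with two indices exchanged. *)
Lemma half_subD (x z : U) : 2^-1 *: (x - z) + z = 2^-1 *: (x + z).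
Proof.
rewrite -{2}[z](@scalerK _ _ 2) ?pnatr_eq0 // -scalerDr scaler_nat mulr2n.
by rewrite addrA subrK.
Qed.

(** The sum is its own opposite after exchanging the indices, so it vanishes
    over a field of characteristic 0. *)
Lemma sum_antisym0 (F : I -> I -> U) :
  (forall i j, F i j + F j i = 0) -> \sum_i \sum_j F i j = 0.
Proof.
move=> FC; apply: (@mulrSn_eq0 1); rewrite mulr2n.
rewrite [X in _ + X]exchange_big -big_split big1 // => i _.
by rewrite -big_split big1 // => j _; apply: FC.
Qed.

(** Three times the sum is the sum over the cyclic permutations of the
    indices.  This is the form in which the Jacobi identity is used when the
    monomial y^i y^j y^k is invariant under cyclic permutations. *)
Lemma sum_cyclic0 (F : I -> I -> I -> U) :
  (forall i j k, F i j k + F j k i + F k i j = 0) ->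
  \sum_i \sum_j \sum_k F i j k = 0.
Proof.
move=> FC; apply: (@mulrSn_eq0 2); rewrite !mulrSr mulr0n add0r.
have rot (G : I -> I -> I -> U) :
    \sum_i \sum_j \sum_k G i j k = \sum_i \sum_j \sum_k G j k i.
  rewrite [RHS]exchange_big; apply: eq_bigr => i _.
  by rewrite [RHS]exchange_big.
rewrite [X in _ + X + _](rot F) [X in _ + _ + X](rot F).
rewrite [X in _ + _ + X](rot (fun i j k => F j k i)).
do 3 (rewrite -!big_split big1 // => ? _).
exact: FC.
Qed.

End SymmetrySums.

(** * Structure constants *)

Section StructureConstants.
Context (R : realType) (g : vectType R) (br : {bilinear g -> g -> g}).
Context (Hg : is_lie_bracket br) (n : nat) (e : n.-tuple g).
Context (He : basis_of fullv e).
Implicit Types i j k a : 'I_n.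
Local Notation f := (struct_const br e).

Lemma lie_bracketC x y : br x y = - br y x.
Proof.
have [alt _] := Hg; apply/eqP; rewrite -addr_eq0.
by have := alt (x + y); rewrite linearDl !linearDr /= !alt add0r addr0 => ->.
Qed.

Lemma struct_constE i j : br e`_i e`_j = \sum_k f i j k *: e`_k.
Proof. exact: coord_basis He (memvf _). Qed.

Lemma struct_constC i j k : f i j k = - f j i k.
Proof. by rewrite /struct_const lie_bracketC linearN. Qed.

Lemma struct_const_br2 i j k a :
  coord e a (br (br e`_i e`_j) e`_k) = \sum_l f l k a * f i j l.
Proof.
rewrite struct_constE linear_sumlz linear_sum /=; apply: eq_bigr => l _.
by rewrite linearZl_LR linearZ /= mulrC.
Qed.

(** Coordinates of the cyclic sum of [[e_i, e_j], e_k]. *)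
Lemma struct_const_jacobi i j k a :
  \sum_l f l k a * f i j l + \sum_l f l i a * f j k l
  + \sum_l f l j a * f k i l = 0.
Proof.
have [_ jac] := Hg; rewrite -!struct_const_br2 -!linearD /=.
have /(congr1 (fun z => - coord e a z)) := jac e`_i e`_j e`_k.
rewrite linear0 oppr0 => <-; rewrite -linearN /= !opprD -!lie_bracketC.
by rewrite -addrA addrC.
Qed.

End StructureConstants.

(** * The square of the covariant differential *)

Fact endgen_is_linear (R : realType) n (V : vectType R) : linear (@endgen R n V).
Proof.
move=> c A B; apply/ffunP=> I; rewrite !ffunE.
case: ifP => _; last by rewrite scaler0 addr0.
apply/matrixP=> i j; rewrite !mxE !lfunE /= lfunE linearP /= mpolyCD.
by rewrite mpolyCM.
Qed.

HB.instance Definition _ (R : realType) n (V : vectType R) :=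
  GRing.isLinear.Build R 'End(V) (cov_weil n V) _ (@endgen R n V)
    (@endgen_is_linear R n V).

Section CovariantDifferential.
Context (R : realType) (n : nat) (V : vectType R).
Local Notation W := (cov_weil n V).
Context (f : 'I_n -> 'I_n -> 'I_n -> R) (t : 'I_n -> 'End(V)).
Context (fC : forall i j k, f i j k = - f j i k).
Context (jac : forall i j k a,
  \sum_l f l k a * f i j l + \sum_l f l i a * f j k l
  + \sum_l f l j a * f k i l = 0).
Context (tP : forall i j,
  \sum_k f i j k *: t k = ((t i \o t j) - (t j \o t i))%VF).
Context (d : {linear W -> W}) (Hd : is_covariant_differential f t d).

Local Notation v a := (vgen V a).
Local Notation y a := (ygen V a).
Local Notation E A := (@endgen R n V A).
Local Notation C := (@curvature R n V t).

(** This lemma and the next one collect the cubic terms of d d v^a and d d y^a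
    in the form (coefficient) y^l y^m w^k, where w is v or y: the coefficient is
    then a quadratic expression in the structure constants. *)
Lemma sum_yyM (c : 'I_n -> 'I_n -> R) (b : 'I_n -> 'I_n -> 'I_n -> R)
    (w : 'I_n -> W) :
  \sum_j \sum_k c j k *: ((\sum_l \sum_m b l m j *: (y l * y m)) * w k)
  = \sum_l \sum_m \sum_k (\sum_j c j k * b l m j) *: (y l * y m * w k).
Proof.
under eq_bigr => j _.
  under eq_bigr => k _.
    rewrite mulr_suml scaler_sumr.
    under eq_bigr => l _.
      rewrite mulr_suml scaler_sumr.
      under eq_bigr => m _ do rewrite -cov_weil_scaleAl scalerA.
      over.
    over.
  rewrite exchange_big.
  under eq_bigr => l _ do rewrite exchange_big.
  over.
rewrite exchange_big; apply: eq_bigr => l _.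
rewrite exchange_big; apply: eq_bigr => m _.
rewrite exchange_big; apply: eq_bigr => k _.
by rewrite scaler_suml.
Qed.

Lemma sum_Myy (c : 'I_n -> 'I_n -> R) (b : 'I_n -> 'I_n -> 'I_n -> R)
    (w : 'I_n -> W) :
  \sum_j \sum_k c j k *: (y j * (\sum_l \sum_m b l m k *: (y l * w m)))
  = \sum_j \sum_l \sum_m (\sum_k c j k * b l m k) *: (y j * y l * w m).
Proof.
apply: eq_bigr => j _.
under eq_bigr => k _.
  rewrite mulr_sumr scaler_sumr.
  under eq_bigr => l _.
    rewrite mulr_sumr scaler_sumr.
    under eq_bigr => m _ do rewrite -cov_weil_scaleAr scalerA mulrA.
    over.
  over.
rewrite exchange_big; apply: eq_bigr => l _.
rewrite exchange_big; apply: eq_bigr => m _.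
by rewrite scaler_suml.
Qed.

Lemma covd_vM a x : d (v a * x) = d (v a) * x + v a * d x.
Proof.
have [[_ _ dM] _ _ _] := Hd.
by rewrite (dM _ _ _ (@vgen_homogeneous _ _ _ a)) sqrrN expr1n mul1r.
Qed.

Lemma covd_yM a x : d (y a * x) = d (y a) * x - y a * d x.
Proof.
have [[_ _ dM] _ _ _] := Hd.
by rewrite (dM _ _ _ (@ygen_homogeneous _ _ _ a)) expr1 mulN1r mulNr.
Qed.

Lemma covd_dvM a x : d (d (v a) * x) = d (d (v a)) * x - d (v a) * d x.
Proof.
have [[_ dh dM] _ _ _] := Hd.
by rewrite (dM _ _ _ (dh _ _ (@vgen_homogeneous _ _ _ a))) -signr_odd expr1 mulN1r mulNr.
Qed.

Lemma covd_dyM a x : d (d (y a) * x) = d (d (y a)) * x + d (y a) * d x.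
Proof.
have [[_ dh dM] _ _ _] := Hd.
by rewrite (dM _ _ _ (dh _ _ (@ygen_homogeneous _ _ _ a))) -signr_odd expr0 mul1r.
Qed.

(** With the next lemma, the reason why d d is a derivation: the two
    cross terms have opposite signs, since v^a and d v^a have opposite parities. *)
Lemma covd2_vM a x : d (d (v a * x)) = d (d (v a)) * x + v a * d (d x).
Proof. by rewrite covd_vM linearD /= covd_dvM covd_vM addrA subrK. Qed.

Lemma covd2_yM a x : d (d (y a * x)) = d (d (y a)) * x + y a * d (d x).
Proof.
by rewrite covd_yM linearB /= covd_dyM covd_yM opprD opprK addrA addrK.
Qed.

Lemma curvature_yC a : y a * C = C * y a.
Proof.
rewrite mulr_sumr mulr_suml; apply: eq_bigr => b _.
by rewrite mulrA ygen_vgen -mulrA ygen_endgen mulrA.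
Qed.

Lemma covd2_v a : d (d (v a)) = 0.
Proof.
have [_ dy dv _] := Hd.
rewrite dv linearN linear_sum /=.
under eq_bigr => j _.
  rewrite linear_sum /=.
  under eq_bigr => k _.
    rewrite linearZ /= covd_yM dy dv mulrBl mulrN opprK !scalerDr scalerN.
    rewrite -cov_weil_scaleAl (scalerA (f j k a)).
    over.
  rewrite !big_split sumrN /=.
  over.
rewrite !big_split sumrN /= sum_yyM sum_Myy.
rewrite sum_antisym0 => [|j k]; last first.
  by rewrite vgenC (fC k) scaleNr subrr.
(* What remains is a sum of c(l, m, k) y^l y^m v^k; only the part of c that is
   antisymmetric in l and m counts, and it is a Jacobi sum. *)
rewrite sub0r addrC -sumrB.
under eq_bigr => l _ do rewrite -sumrB.
rewrite sum_antisym0 ?oppr0 // => l m.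
rewrite -!sumrB -big_split big1 // => k _ /=.
rewrite -!scalerBl (ygenN _ m l) mulNr scalerN -scalerBl.
have -> : \sum_j f l j a * f m k j = - \sum_j f j l a * f m k j.
  by rewrite -sumrN; apply: eq_bigr => j _; rewrite fC mulNr.
have -> : \sum_j f m j a * f l k j = \sum_j f j m a * f k l j.
  by apply: eq_bigr => j _; rewrite fC (fC l) mulrNN.
have half p q : \sum_j f j k a / 2 * f p q j = 2^-1 * \sum_j f j k a * f p q j.
  by rewrite mulr_sumr; apply: eq_bigr => j _; rewrite mulrAC mulrC.
have -> : \sum_j f j k a / 2 * f m l j = - (2^-1 * \sum_j f j k a * f l m j).
  rewrite half -mulrN -sumrN; congr (_ * _); apply: eq_bigr => j _.
  by rewrite (fC m) mulrN.
rewrite half; set J := _ - _.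
have -> : J = - (\sum_j f j k a * f l m j + \sum_j f j l a * f m k j
    + \sum_j f j m a * f k l j) by rewrite /J; field.
by rewrite jac oppr0 scale0r.
Qed.

Lemma covd_y_central a x : d (y a) * x = x * d (y a).
Proof. by have [_ dy _ _] := Hd; rewrite dy; exact: y_valueC f a x. Qed.

Lemma covd2_y a : d (d (y a)) = 0.
Proof.
have [_ dy dv _] := Hd.
(* d y^k is even and has no component in End V, hence is central; so the two
   halves of d (y^j y^k) contribute equally after exchanging j and k, which
   absorbs the factor 1/2 in d y^a. *)
have dq : d (\sum_j \sum_k f j k a *: (y j * y k)) =
    2 *: \sum_j \sum_k f j k a *: (d (y j) * y k).
  rewrite linear_sum scaler_nat mulr2n [X in _ = _ + X]exchange_big -big_split.
  apply: eq_bigr => j _; rewrite linear_sum -big_split; apply: eq_bigr => k _ /=.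
  rewrite linearZ /= covd_yM -(covd_y_central k) scalerBr.
  by rewrite (fC k j) scaleNr.
rewrite dy linearB linearZ /= dq scalerA mulVf ?pnatr_eq0 // scale1r dv.
under [X in _ - X]eq_bigr => j _.
  under eq_bigr => k _.
    rewrite dy mulrBl scalerBr -cov_weil_scaleAl !scalerA (mulrC (f j k a)).
    rewrite -scalerA; over.
  rewrite sumrB -scaler_sumr; over.
rewrite sumrB -scaler_sumr sum_yyM opprB addrA addrAC.
have -> : \sum_j \sum_k f j k a *: (v j * y k) =
    - \sum_j \sum_k f j k a *: (y j * v k).
  rewrite exchange_big -sumrN; apply: eq_bigr => j _.
  rewrite -sumrN; apply: eq_bigr => k _.
  by rewrite fC scaleNr ygen_vgen.
rewrite opprK addNr add0r sum_cyclic0 ?scaler0 // => l m k.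
(* Moving a y past two others costs two signs. *)
have yyyC (b c x : 'I_n) : y b * y c * y x = y c * y x * y b.
  by rewrite (ygenN _ b c) mulNr -!mulrA (ygenN _ b x) mulrN opprK.
by rewrite -(yyyC l m k) (yyyC k l m) -!scalerDl jac scale0r.
Qed.

Lemma covd2_end A : d (d (E A)) = C * E A - E A * C.
Proof.
have [_ dy _ dA] := Hd.
pose ad j (X : W) := E (t j) * X - X * E (t j).
have adD j X : ad j X = E (t j) * X - X * E (t j) by [].
clearbody ad.
have adE j B : E ((t j \o B) - (B \o t j))%VF = ad j (E B).
  by rewrite adD endgenB !endgenM.
have adP j k X : \sum_a f j k a *: ad a X = ad j (ad k X) - ad k (ad j X).
  have := congr1 (@endgen R n V) (tP j k); rewrite endgenB !endgenM linear_sum /= => tjk.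
  transitivity ((\sum_a f j k a *: E (t a)) * X - X * (\sum_a f j k a *: E (t a))).
    rewrite mulr_suml mulr_sumr -sumrB; apply: eq_bigr => a _.
    by rewrite adD scalerBr cov_weil_scaleAl cov_weil_scaleAr.
  under eq_bigr => a _ do rewrite -linearZ /=.
  by rewrite tjk !adD commutator_jacobi.
(* In this form the first summand gives [C, A]; the two others cancel each other. *)
have dd : d (d (E A)) = \sum_a (v a * ad a (E A) -
    2^-1 *: \sum_j \sum_k f j k a *: (y j * y k * ad a (E A))
    - \sum_b y a * y b * ad b (ad a (E A))).
  rewrite dA linear_sum; apply: eq_bigr => a _ /=.
  rewrite covd_yM dy dA adE mulrBl -cov_weil_scaleAl mulr_suml mulr_sumr.
  under [X in _ *: X]eq_bigr => j _.
    rewrite mulr_suml.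
    under eq_bigr => k _ do rewrite -cov_weil_scaleAl.
    over.
  by under [X in _ - X]eq_bigr => b _ do rewrite adE adE mulrA.
have -> : C * E A - E A * C = \sum_a v a * ad a (E A).
  rewrite mulr_suml mulr_sumr -sumrB; apply: eq_bigr => a _.
  by rewrite adD mulrBr !mulrA (vgenC a (E A)).
rewrite dd !sumrB -scaler_sumr -addrA -opprD exchange_big.
under eq_bigr => j _.
  rewrite exchange_big.
  under eq_bigr => k _.
    under eq_bigr => a _ do rewrite cov_weil_scaleAr.
    rewrite -mulr_sumr adP.
    over.
  over.
rewrite scaler_sumr -big_split.
under eq_bigr => j _ do rewrite scaler_sumr -big_split.
rewrite sum_antisym0 ?subr0 // => j k /=.
(* f_{jk}^a [tau_a, A] has become a difference of double commutators; with the
   other quadratic term it gives a sum symmetric in j and k. *)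
have sym b (p q : W) : 2^-1 *: (b * (p - q)) + b * q = 2^-1 *: (b * (p + q)).
  by rewrite mulrBr half_subD mulrDr.
rewrite sym (sym (y k * y j)) (ygenN _ k j).
rewrite (mulNr (y j * y k)) scalerN.
by rewrite [ad k _ + _]addrC subrr.
Qed.

(** The general form of the theorem, for any antisymmetric constants f
    satisfying the Jacobi identity and endomorphisms t with the corresponding
    commutators. *)
Lemma covd2 x : d (d x) = C * x - x * C.
Proof.
elim/cov_weil_ind: x => [A|x z IHx IHz|a x IH|a x IH].
- exact: covd2_end.
- by rewrite !linearD /= IHx IHz mulrDr mulrDl opprD addrACA.
- by rewrite covd2_vM covd2_v mul0r add0r IH mulrBr !mulrA (vgenC a C).
- by rewrite covd2_yM covd2_y mul0r add0r IH mulrBr !mulrA curvature_yC.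
Qed.

End CovariantDifferential.

Theorem proposition3p1 (R : realType)
    (g : vectType R) (br : {bilinear g -> g -> g}) (Hg : is_lie_bracket br)
    (V : vectType R) (tau : {linear g -> 'End(V)}) (Htau : is_lie_representation br tau)
    (n : nat) (e : n.-tuple g) (He : basis_of fullv e)
    (d : cov_weil n V -> cov_weil n V)
    (Hd : is_covariant_differential
            (fun i j k : 'I_n => struct_const br e i j k) (fun a : 'I_n => tau e`_a) d)
    (x : cov_weil n V) :
  d (d x) = supercomm (curvature (fun a : 'I_n => tau e`_a)) x.
Proof.
rewrite (@supercomm_even _ _ _ 2) //; last exact: curvature_homogeneous.
have [[d_linear _ _] _ _ _] := Hd.
pose D : {linear cov_weil n V -> cov_weil n V} :=
  HB.pack d (GRing.isLinear.Build _ _ _ _ d d_linear).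
apply: (@covd2 _ _ _ _ _ _ _ _ D Hd).
- exact: struct_constC.
- exact: struct_const_jacobi.
move=> i j; rewrite -Htau (struct_constE br He) linear_sum.
by apply: eq_bigr => k _; rewrite linearZ.
Qed.
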